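(* Let $\rho\in[0,1)$, $\lambda>0$, $\theta_0\in\mathbb R^d$, and let $(\theta_k)_{k\ge0}$ be iterates with $\theta_{k+1}=\theta_k+s_k$. Let $g_k:=\nabla f(\theta_k)$ be the gradient of the objective and $F_k:=F(\theta_k)$ the Fisher information matrix at $\theta_k$ (defined in the context). Put $\kappa(0)=1$, $\kappa(i)=1-\rho$ for $i\ge1$, and $$\bar F_k:=\sum_{i=0}^k\kappa(i)\rho^{k-i}F_i ,$$ and assume $\bar F_k$ is invertible for every $k\ge 0$. Suppose that for every $k\ge0$ the step $s_k$ is the SO-KLD-WRM step at $\theta_k$, i.e. the solution of $$\min_{s\in\mathbb R^d}\ g_k^Ts+\lambda\sum_{i=0}^k\kappa(i)\rho^{k-i}\,\tilde{\mathbb D}_{KL}(\theta_i,\theta_k+s),$$ where $$\tilde{\mathbb D}_{KL}(\theta_i,\theta_k+s):=\frac12\Bigl(s+\sum_{j=i}^{k-1}s_j\Bigr)^TF_i\Bigl(s+\sum_{j=i}^{k-1}s_j\Bigr).$$ Then for every integer $k\ge0$, $$s_k=-\lambda^{-1}\bar F_k^{-1}\,[\,g_k-\rho\, g_{k-1}\,],$$ where $g_{-1}:=0$ by convention.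
   Context: Setting: a parametric model $p_\theta(y|x)=p(y|h_\theta(x))$, $\theta\in\mathbb R^d$ (with $h_\theta$ the output of a neural network), a finite dataset $\mathcal D=\{(x_i,y_i)\}_i$, and the objective $f(\theta)=\sum_{(x_i,y_i)\in\mathcal D}-\log p(y_i|h_\theta(x_i))$, assumed differentiable. With $\hat q$ the empirical distribution of the inputs $x$, the Fisher information matrix is $$F(\theta)=\mathbb E_{x\sim\hat q,\ y\sim p_\theta(y|x)}\bigl[\nabla_\theta\log p_\theta(y|x)\,\nabla_\theta\log p_\theta(y|x)^T\bigr],$$ a symmetric positive semidefinite $d\times d$ matrix. The quantity $\tilde{\mathbb D}_{KL}$ is a second-order approximation of a symmetric KL-divergence; only the displayed formula for it is used. Conventions: empty sums are zero, in particular $\sum_{j=k}^{k-1}s_j=0$; $\rho^0=1$ also when $\rho=0$. The steps are defined recursively: the problem defining $s_k$ involves the earlier steps $s_0,\dots,s_{k-1}$. *)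

(* Defs.v *)
From HB Require Import structures.
From mathcomp Require Import all_boot all_order all_algebra.
From mathcomp Require Import all_classical all_reals all_analysis.
Set Implicit Arguments.
Unset Strict Implicit.
Unset Printing Implicit Defensive.
Import Order.TTheory GRing.Theory Num.Theory.
Import numFieldNormedType.Exports.
Local Open Scope classical_set_scope.
Local Open Scope ring_scope.

Definition gradient (R : realType) (d : nat) (f : 'cV[R]_d -> R)
    (theta : 'cV[R]_d) : 'cV[R]_d :=
  \col_i 'D_(delta_mx i 0) f theta.

(* [P z] is the distribution p(. | z) of the output y, for z = h theta x, and
   [p z] its density with respect to the reference measure [mu] (for instance
   the counting measure for classification, Lebesgue for regression). *)
Definition has_density (R : realType) (dY : measure_display)
    (Y : measurableType dY) (Z : Type) (mu : {measure set Y -> \bar R})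
    (P : Z -> probability Y R) (p : Z -> Y -> R) : Prop :=
  forall z : Z,
    [/\ forall y, 0 <= p z y,
        measurable_fun setT (p z) &
        forall A : set Y, measurable A ->
          P z A = (\int[mu]_(y in A) (p z y)%:E)%E].

Definition loglik (R : realType) (d : nat) (X Y Z : Type)
    (h : 'cV[R]_d -> X -> Z) (p : Z -> Y -> R) (x : X) (y : Y)
    (theta : 'cV[R]_d) : R :=
  ln (p (h theta x) y).

Definition objective (R : realType) (d N : nat) (X Y Z : Type)
    (h : 'cV[R]_d -> X -> Z) (p : Z -> Y -> R) (data : 'I_N -> X * Y)
    (theta : 'cV[R]_d) : R :=
  \sum_(n < N) - loglik h p (data n).1 (data n).2 theta.

Definition score (R : realType) (d : nat) (X Y Z : Type)
    (h : 'cV[R]_d -> X -> Z) (p : Z -> Y -> R) (theta : 'cV[R]_d)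
    (x : X) (y : Y) : 'cV[R]_d :=
  gradient (loglik h p x y) theta.

(* The outer expectation, over the empirical distribution of the inputs, is the
   average over the dataset. *)
Definition fisher (R : realType) (d N : nat) (X : Type)
    (dY : measure_display) (Y : measurableType dY) (Z : Type)
    (P : Z -> probability Y R) (h : 'cV[R]_d -> X -> Z) (p : Z -> Y -> R)
    (data : 'I_N -> X * Y) (theta : 'cV[R]_d) : 'M[R]_d :=
  N%:R^-1 *: \sum_(n < N) \matrix_(a, b)
    fine ('E_(P (h theta (data n).1))[fun y =>
      (score h p theta (data n).1 y *m (score h p theta (data n).1 y)^T) a b])%E.

(* Well-posedness of the expectation in [fisher]: at a data input, almost every
   output has a score, and the entries of the outer product are integrable.
   Since [ln] is 0 on nonpositive numbers, positivity of the density near theta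
   must be asked for separately. *)
Definition fisher_defined (R : realType) (d N : nat) (X : Type)
    (dY : measure_display) (Y : measurableType dY) (Z : Type)
    (P : Z -> probability Y R) (h : 'cV[R]_d -> X -> Z) (p : Z -> Y -> R)
    (data : 'I_N -> X * Y) (theta : 'cV[R]_d) : Prop :=
  forall n : 'I_N,
    {ae P (h theta (data n).1), forall y,
       (\forall t \near theta, 0 < p (h t (data n).1) y) /\
       differentiable (loglik h p (data n).1 y) theta} /\
    forall a b : 'I_d, (P (h theta (data n).1)).-integrable setT (fun y =>
      ((score h p theta (data n).1 y *m (score h p theta (data n).1 y)^T) a b)%:E).

Definition kappa (R : realType) (rho : R) (i : nat) : R :=
  if i is 0 then 1 else 1 - rho.

Definition Fbar (R : realType) (d : nat) (rho : R) (F : nat -> 'M[R]_d)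
    (k : nat) : 'M[R]_d :=
  \sum_(0 <= i < k.+1) (kappa rho i * rho ^+ (k - i)) *: F i.

(* The approximate symmetric KL-divergence between theta_i and theta_k + v,
   where [st j] is the step from theta_j to theta_(j+1). *)
Definition skl_approx (R : realType) (d : nat) (F : nat -> 'M[R]_d)
    (st : nat -> 'cV[R]_d) (i k : nat) (v : 'cV[R]_d) : R :=
  let w := v + \sum_(i <= j < k) st j in
  2^-1 * (w^T *m F i *m w) 0 0.

Definition wrm_objective (R : realType) (d : nat) (rho lambda : R)
    (g : nat -> 'cV[R]_d) (F : nat -> 'M[R]_d) (st : nat -> 'cV[R]_d)
    (k : nat) (v : 'cV[R]_d) : R :=
  ((g k)^T *m v) 0 0 +
  lambda * \sum_(0 <= i < k.+1)
             kappa rho i * rho ^+ (k - i) * skl_approx F st i k v.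

Definition is_minimizer (R : realType) (d : nat) (J : 'cV[R]_d -> R)
    (v : 'cV[R]_d) : Prop :=
  forall w : 'cV[R]_d, J v <= J w.

(* [previous g k] is g_(k-1), with g_(-1) = 0. *)
Definition previous (R : realType) (d : nat) (g : nat -> 'cV[R]_d)
    (k : nat) : 'cV[R]_d :=
  if k is k'.+1 then g k' else 0.

(* Main.v *)
(** Each [wrm_objective] is a quadratic whose matrices are symmetric, so its
    minimizer makes the gradient [g_k + lambda r_k] vanish, where
    [r_k = \sum_(i <= k) kappa(i) rho^(k-i) F_i (s_i + ... + s_k)].  Splitting off
    the last step of each inner sum gives [r_k = Fbar_k s_k + rho r_(k-1)], and
    substituting [lambda r_k = - g_k] and [lambda r_(k-1) = - g_(k-1)] leaves the
    claimed formula. *)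
Require Import Defs.
From HB Require Import structures.
From mathcomp Require Import all_boot all_order all_algebra.
From mathcomp Require Import all_classical all_reals all_analysis.
From mathcomp Require Import ring.
Set Implicit Arguments.
Unset Strict Implicit.
Unset Printing Implicit Defensive.
Import Order.TTheory GRing.Theory Num.Theory.
Import numFieldNormedType.Exports.
Local Open Scope classical_set_scope.
Local Open Scope ring_scope.

(** For small [t] of sign opposite to [b], the linear term would dominate and make the expression
    negative. *)
Lemma linear_coef_eq0 (R : realFieldType) (b c : R) :
  (forall t : R, 0 <= t * b + t ^+ 2 * c) -> b = 0.
Proof.
move=> pos; apply/eqP/negPn/negP => b0.
have C0 : 0 < `|c| + 1 by rewrite ltr_wpDl.
have b2 : 0 < b ^+ 2 by rewrite exprn_even_gt0.
(* The shift by 1 keeps the denominator positive when [c = 0] and makes [|c| + 1 - c] strictly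
   positive, so the value at this [t] is negative. *)
have := pos (- b / (`|c| + 1)).
have -> : - b / (`|c| + 1) * b + (- b / (`|c| + 1)) ^+ 2 * c =
    - (b ^+ 2 / (`|c| + 1) ^+ 2 * (`|c| + 1 - c)).
  by field; rewrite gt_eqF.
rewrite oppr_ge0 leNgt mulr_gt0 //; first by rewrite divr_gt0 // exprn_gt0.
by rewrite subr_gt0 (le_lt_trans (ler_norm c)) // ltrDl.
Qed.

Lemma dot_eq0 (R : pzRingType) (d : nat) (u : 'cV[R]_d) :
  (forall w : 'cV[R]_d, (u^T *m w) 0 0 = 0) -> u = 0.
Proof.
move=> u0; apply/colP => i; rewrite mxE -[RHS](u0 (delta_mx i 0)).
by rewrite -colE !mxE.
Qed.

(** Symmetry merges the two cross terms, which cancels the factor 1/2: [A *m v] is the gradient of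
    the half quadratic form. *)
Lemma quad_expand (R : realFieldType) (d : nat) (A : 'M[R]_d)
    (v w : 'cV[R]_d) (t : R) :
  A^T = A ->
  2^-1 * ((v + t *: w)^T *m A *m (v + t *: w)) 0 0 =
  2^-1 * (v^T *m A *m v) 0 0 + t * ((A *m v)^T *m w) 0 0 +
  t ^+ 2 * (2^-1 * (w^T *m A *m w) 0 0).
Proof.
move=> symA.
have swap : (w^T *m A *m v) 0 0 = (v^T *m A *m w) 0 0.
  have -> : w^T *m A *m v = (v^T *m A *m w)^T.
    by rewrite !trmx_mul trmxK symA mulmxA.
  by rewrite mxE.
rewrite trmx_mul symA [(v + _)^T]linearD /= [(t *: w)^T]linearZ /= !mulmxDl !mulmxDr.
rewrite -!scalemxAl -!scalemxAr.
have entryD (a b : 'M[R]_1) : (a + b) 0 0 = a 0 0 + b 0 0 by rewrite mxE.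
have entryZ c (a : 'M[R]_1) : (c *: a) 0 0 = c * a 0 0 by rewrite mxE.
by rewrite !(entryD, entryZ) swap; field.
Qed.

(** Entries [(a, b)] and [(b, a)] are expectations of the same function, since the product of two
    score coordinates commutes. *)
Lemma fisher_sym (R : realType) (d N : nat) (X : Type)
    (dY : measure_display) (Y : measurableType dY) (Z : Type)
    (P : Z -> probability Y R) (h : 'cV[R]_d -> X -> Z) (p : Z -> Y -> R)
    (data : 'I_N -> X * Y) (theta : 'cV[R]_d) :
  (fisher P h p data theta)^T = fisher P h p data theta.
Proof.
rewrite /fisher linearZ /= raddf_sum /=; congr (_ *: _).
apply: eq_bigr => n _; apply/matrixP => a b; rewrite !mxE.
congr (fine (expectation _ _)); apply/funext => y.
by rewrite !mxE; apply: eq_bigr => j _; rewrite !mxE mulrC.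
Qed.

(** For symmetric [F i], this is the gradient in [v] of the weighted divergence sum, without the
    factor [lambda]; at [v = st k] it is the [r_k] of the overview. *)
Definition kl_gradient (R : realType) (d : nat) (rho : R) (F : nat -> 'M[R]_d)
    (st : nat -> 'cV[R]_d) (k : nat) (v : 'cV[R]_d) : 'cV[R]_d :=
  \sum_(0 <= i < k.+1)
    (kappa rho i * rho ^+ (k - i)) *: (F i *m (v + \sum_(i <= j < k) st j)).

Lemma wrm_objective_expand (R : realType) (d : nat) (rho lambda : R)
    (g : nat -> 'cV[R]_d) (F : nat -> 'M[R]_d) (st : nat -> 'cV[R]_d)
    (k : nat) (v w : 'cV[R]_d) (t : R) :
  (forall i, (F i)^T = F i) ->
  wrm_objective rho lambda g F st k (v + t *: w) =
  wrm_objective rho lambda g F st k v +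
  (t * ((g k + lambda *: kl_gradient rho F st k v)^T *m w) 0 0 +
   t ^+ 2 * (lambda * \sum_(0 <= i < k.+1)
     kappa rho i * rho ^+ (k - i) * (2^-1 * (w^T *m F i *m w) 0 0))).
Proof.
move=> symF.
have -> : ((g k + lambda *: kl_gradient rho F st k v)^T *m w) 0 0 =
    ((g k)^T *m w) 0 0 + lambda * \sum_(0 <= i < k.+1)
      kappa rho i * rho ^+ (k - i) *
      ((F i *m (v + \sum_(i <= j < k) st j))^T *m w) 0 0.
  rewrite linearD /= linearZ /= mulmxDl -scalemxAl /kl_gradient raddf_sum /=.
  rewrite mulmx_suml mxE [X in _ + X]mxE summxE; congr (_ + _ * _).
  by apply: eq_bigr => i _; rewrite linearZ /= -scalemxAl mxE.
rewrite /wrm_objective mulmxDr -scalemxAr.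
have -> (a b : 'M[R]_1) : (a + t *: b) 0 0 = a 0 0 + t * b 0 0 by rewrite !mxE.
(* Past steps are absorbed into the base point: [addrAC] moves [t *: w] to the end, as [quad_expand]
   requires. *)
under eq_bigr => i _ do
  rewrite /skl_approx addrAC quad_expand // !mulrDr
    [_ * (t * _)]mulrCA [_ * (t ^+ 2 * _)]mulrCA.
by rewrite !big_split /= -!mulr_sumr; ring.
Qed.

(** Along each line [v + t *: w] the increment of the objective is [t * b + t ^+ 2 * c], nonnegative
    by minimality, so [b] vanishes for every direction [w]. *)
Lemma wrm_stationary (R : realType) (d : nat) (rho lambda : R)
    (g : nat -> 'cV[R]_d) (F : nat -> 'M[R]_d) (st : nat -> 'cV[R]_d)
    (k : nat) (v : 'cV[R]_d) :
  (forall i, (F i)^T = F i) ->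
  is_minimizer (wrm_objective rho lambda g F st k) v ->
  lambda *: kl_gradient rho F st k v = - g k.
Proof.
move=> symF minv; apply/eqP; rewrite -addr_eq0 addrC; apply/eqP.
apply: dot_eq0 => w; apply: linear_coef_eq0 => t.
by have := minv (v + t *: w); rewrite wrm_objective_expand // lerDl; exact.
Qed.

Lemma kl_gradient0 (R : realType) (d : nat) (rho : R) (F : nat -> 'M[R]_d)
    (st : nat -> 'cV[R]_d) : kl_gradient rho F st 0 (st 0) = Fbar rho F 0 *m st 0.
Proof.
by rewrite /kl_gradient /Fbar !big_nat1 big_geq // addr0 -scalemxAl.
Qed.

Lemma kl_gradientS (R : realType) (d : nat) (rho : R) (F : nat -> 'M[R]_d)
    (st : nat -> 'cV[R]_d) (k : nat) :
  kl_gradient rho F st k.+1 (st k.+1) =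
  Fbar rho F k.+1 *m st k.+1 + rho *: kl_gradient rho F st k (st k).
Proof.
rewrite /kl_gradient /Fbar mulmx_suml.
under eq_bigr => i _ do rewrite mulmxDr scalerDr scalemxAl.
rewrite big_split /=; congr (_ + _).
(* The term [i = k.+1] drops out because its inner sum of earlier steps is empty. *)
rewrite big_nat_recr //= [X in _ *m X]big_geq // mulmx0 scaler0 addr0.
rewrite scaler_sumr; apply: eq_big_nat => i /andP[_ ik].
(* The last past step [st k] takes the place of [v] at stage [k], and one factor [rho] comes out of
   the weight. *)
by rewrite big_nat_recr //= [_ + st k]addrC subSn // exprS scalerA mulrCA.
Qed.

Theorem proposition4p1 (R : realType) (d N : nat)
    (X : Type) (dY : measure_display) (Y : measurableType dY) (Z : Type)
    (mu : {measure set Y -> \bar R})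
    (P : Z -> probability Y R) (p : Z -> Y -> R) (h : 'cV[R]_d -> X -> Z)
    (data : 'I_N -> X * Y)
    (rho lambda : R) (theta st : nat -> 'cV[R]_d)
    (hN : (0 < N)%N)
    (hp : has_density mu P p)
    (hdata : forall (t : 'cV[R]_d) (n : 'I_N),
       0 < p (h t (data n).1) (data n).2)
    (hf : forall t : 'cV[R]_d, differentiable (objective h p data) t)
    (hF : forall k : nat, fisher_defined P h p data (theta k))
    (hrho : 0 <= rho < 1) (hlambda : 0 < lambda)
    (htheta : forall k : nat, theta k.+1 = theta k + st k) :
  let g := fun k : nat => gradient (objective h p data) (theta k) in
  let F := fun k : nat => fisher P h p data (theta k) in
  (forall k : nat, Fbar rho F k \in unitmx) ->
  (forall k : nat, is_minimizer (wrm_objective rho lambda g F st k) (st k)) ->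
  forall k : nat,
    st k = - (lambda^-1 *: (invmx (Fbar rho F k) *m (g k - rho *: previous g k))).
Proof.
move=> g F invF minst k.
have stat j : lambda *: kl_gradient rho F st j (st j) = - g j.
  by apply: wrm_stationary (minst j) => i; exact: fisher_sym.
(* At [k = 0] the convention [previous g 0 = 0] matches the absence of an earlier stage; otherwise
   stationarity is used at two consecutive stages. *)
have normal : lambda *: (Fbar rho F k *m st k) = - (g k - rho *: previous g k).
  case: k => [|k]; first by rewrite -kl_gradient0 stat scaler0 subr0.
  have -> : Fbar rho F k.+1 *m st k.+1 =
      kl_gradient rho F st k.+1 (st k.+1) - rho *: kl_gradient rho F st k (st k).
    by rewrite kl_gradientS addrK.
  by rewrite scalerBr stat scalerA mulrC -scalerA stat scalerN opprD.
rewrite -scalerN -mulmxN -normal -scalemxAr mulKmx // scalerA.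
by rewrite mulVf ?scale1r // gt_eqF.
Qed.
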